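(* Let $p\ge 2$, let $T\subset \mathbb{N}$ be a numerical semigroup minimally generated by $\{\lambda_1,\lambda_2\}$, let $j\in \{1,\ldots,p\}$, and let $\{q_i\mid i \in \{1,\ldots,p\}\setminus\{j\}\}\subset \mathbb{N}$. Then the affine semigroup $$S=\mathbb{N}^p\setminus \{(x_1,\ldots ,x_p)\in\mathbb{N}^p \mid x_j\notin T\text{ and } x_i< q_i\ \ \forall i\in \{1,\ldots,p\}\setminus \{j\} \}$$ satisfies the extended Wilf's conjecture, that is, $\mathrm{n}(S)\cdot \mathrm{e}(S)\geq \mathcal{N}(\mathrm{Fb}(S))+1$, for every monomial order $\prec$ on $\mathbb{N}^p$ such that every element of $\mathbb{N}^p$ is preceded by only finitely many elements.
   Context: $\mathbb{N}$ is the set of nonnegative integers. A numerical semigroup is a submonoid of $(\mathbb{N},+)$ with finite complement in $\mathbb{N}$. An affine semigroup is a finitely generated submonoid of $(\mathbb{N}^p,+)$; it has a unique minimal generating set (as a monoid), whose cardinality is its embedding dimension $\mathrm{e}(S)$. An $\mathbb{N}^p$-semigroup is an affine semigroup $S\subset\mathbb{N}^p$ such that $\mathcal{H}(S)=\mathbb{N}^p\setminus S$ is finite. A monomial order $\prec$ on $\mathbb{N}^p$ is a total order such that $a\preceq b$ implies $a+c\preceq b+c$ for all $c\in\mathbb{N}^p$, and $0\preceq c$ for all $c\in\mathbb{N}^p$. The genus is $\mathrm{g}(S)=|\mathcal{H}(S)|$; the Frobenius element $\mathrm{Fb}(S)$ is the maximum of $\mathcal{H}(S)$ with respect to $\prec$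 (with the convention $\mathrm{Fb}(\mathbb{N}^p)=(-1,\ldots,-1)$, preceding all elements of $\mathbb{N}^p$); $\mathrm{n}(S)$ is the cardinality of $\{x\in S\mid x\prec \mathrm{Fb}(S)\}$; and the Frobenius number is $\mathcal{N}(\mathrm{Fb}(S))=\mathrm{n}(S)+\mathrm{g}(S)-1$. Thus the extended Wilf inequality reads $\mathrm{n}(S)\,\mathrm{e}(S)\ge \mathrm{n}(S)+\mathrm{g}(S)$. *)

(* Defs.v *)
From HB Require Import structures.
From mathcomp Require Import all_boot all_order all_algebra finmap.
From mathcomp Require Import boolp classical_sets functions cardinality.

Set Implicit Arguments.
Unset Strict Implicit.
Unset Printing Implicit Defensive.

Import Order.TTheory GRing.Theory Num.Theory.

Local Open Scope classical_set_scope.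
Local Open Scope ring_scope.

Notation "''N^' p" := {ffun 'I_p -> nat}
  (at level 8, p at level 2, format "''N^' p") : type_scope.

(* The number of elements of a finite set (0 if A is infinite). *)
Definition ncard (M : choiceType) (A : set M) : nat := #|` fset_set A|%fset.

Section Monoids.
Variable M : nmodType.
Implicit Types A B S : set M.

Definition submonoid S := S 0 /\ forall x y, S x -> S y -> S (x + y).

(* A generates S: S is the smallest submonoid containing A. *)
Definition generates A S := smallest submonoid A = S.

Definition minimal_generating_set A S :=
  generates A S /\ forall B, B `<=` A -> generates B S -> B = A.

(* get selects the minimal generating set, which is unique when S is a
   submonoid of N^p. *)
Definition embedding_dimension S : nat :=
  ncard (get [set A | minimal_generating_set A S]).

End Monoids.

Definition numerical_semigroup (T : set nat) :=
  submonoid T /\ finite_set (~` T).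

Section NpSemigroups.
Variable p : nat.
Implicit Types (S : set 'N^p) (le : rel 'N^p).

Definition affine_semigroup S :=
  submonoid S /\ exists2 A, finite_set A & generates A S.

Definition gaps S : set 'N^p := ~` S.

Definition Np_semigroup S := affine_semigroup S /\ finite_set (gaps S).

Definition monomial_order le :=
  [/\ [/\ reflexive le, antisymmetric le, transitive le & total le],
      forall a b c : 'N^p, le a b -> le (a + c) (b + c)
    & forall c : 'N^p, le 0 c].

Definition prec le : rel 'N^p := fun a b => le a b && (a != b).

Definition finitely_preceded le :=
  forall a, finite_set [set b | prec le b a].

Definition genus S : nat := ncard (gaps S).

Definition maximum le S : set 'N^p :=
  [set f | S f /\ forall h, S h -> le h f].

(* None stands for (-1, ..., -1), the conventional value when there are no
   gaps, which precedes all elements of N^p. *)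
Definition frobenius_element le S : option 'N^p :=
  xget None (Some @` maximum le (gaps S)).

Definition prec_frobenius le S (x : 'N^p) : bool :=
  if frobenius_element le S is Some f then prec le x f else false.

Definition n_of le S : nat := ncard [set x | S x /\ prec_frobenius le S x].

(* Integer-valued: it is -1 when S is the whole of N^p. *)
Definition frobenius_number le S : int :=
  (n_of le S)%:Z + (genus S)%:Z - 1.

Definition extended_wilf le S : Prop :=
  frobenius_number le S + 1 <= (n_of le S)%:Z * (embedding_dimension S)%:Z.

(* The value of q at j is irrelevant. *)
Definition box_semigroup (T : set nat) (j : 'I_p) (q : 'I_p -> nat) : set 'N^p :=
  ~` [set x : 'N^p | ~ T (x j) /\ forall i, i != j -> (x i < q i)%N].

End NpSemigroups.

(* Main.v *)
Require Import Defs.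
From HB Require Import structures.
From mathcomp Require Import all_boot all_order all_algebra finmap.
From mathcomp Require Import boolp classical_sets functions cardinality.
From mathcomp Require Import zify.

Set Implicit Arguments.
Unset Strict Implicit.
Unset Printing Implicit Defensive.

Import Order.TTheory GRing.Theory Num.Theory.

Local Open Scope classical_set_scope.
Local Open Scope ring_scope.

(** Since e(S) >= 2 for every cofinite submonoid S of N^p, p >= 2, it suffices that
    g(S) <= n(S). A numerical semigroup with two generators is symmetric: with
    f its Frobenius number, x not in T implies f - x in T. The Frobenius element
    of S has j-th coordinate f and i-th coordinate q_i - 1, so reflecting the
    j-th coordinate through f injects the gaps of S into the elements of S
    that precede it. *)

Lemma leq_ncard (M N : choiceType) (h : M -> N) (A : set M) (B : set N) :
  finite_set A -> finite_set B ->
  (forall x, A x -> B (h x)) -> {in A &, injective h} ->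
  (ncard A <= ncard B)%N.
Proof.
move=> finA finB AB inj_h; rewrite /ncard.
rewrite -(card_in_imfset imfset_key (f := h) (p := mem (fset_set A))); last first.
  by move=> x y; rewrite !in_fset_set //; exact: inj_h.
apply/fsubset_leq_card/fsubsetP => _ /imfsetP[x /= xA ->].
move: xA; rewrite !in_fset_set // => /set_mem xA.
exact/mem_set/AB.
Qed.

Lemma ncard_set0 (M : choiceType) : ncard (set0 : set M) = 0%N.
Proof. by rewrite /ncard fset_set0 cardfs0. Qed.

Lemma finite_set_bound (M : choiceType) (A : set M) (h : M -> nat) :
  finite_set A -> exists N, forall x, A x -> (h x < N)%N.
Proof.
move=> finA; exists (\max_(x <- fset_set A) h x).+1 => x Ax.
by rewrite ltnS; apply: leq_bigmax_seq; rewrite // in_fset_set // mem_set.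
Qed.

(** * Generating sets and irreducible elements *)

Section Generation.
Variable M : nmodType.
Implicit Types A B S : set M.

Lemma generatesP A S :
  generates A S <-> [/\ submonoid S, A `<=` S &
    forall B, submonoid B -> A `<=` B -> S `<=` B].
Proof.
split=> [<-|[subS AS minS]].
  split; last by move=> B subB AB x; apply.
  - split=> [B [[B0 _] _] //|x y Sx Sy B [subB AB]].
    by apply: subB.2; [exact: Sx|exact: Sy].
  - by move=> x Ax B [_]; apply.
apply/seteqP; split=> [x|x Sx B [subB AB]]; first exact.
exact: minS subB AB x Sx.
Qed.

(** In $\mathbb{N}^p$ these form the unique minimal generating set, so counting them evaluates
    [embedding_dimension]. *)
Definition atoms S : set M :=
  [set x | [/\ S x, x <> 0 &
    forall y z, S y -> S z -> x = y + z -> y = 0 \/ z = 0]].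

(** Removing an atom [a] from [S] leaves a submonoid, since [a] is no sum of two nonzero elements.
    If [A] missed [a], this smaller submonoid would contain [A]. *)
Lemma atoms_sub_generating A S : generates A S -> atoms S `<=` A.
Proof.
move=> /generatesP[subS AS minS] a [Sa a0 irr_a]; apply: contrapT => nAa.
have [||_ /(_ erefl)//] := minS (S `\ a) _ _ a Sa; last first.
  by move=> x Ax; split; [exact: AS|move=> xa; apply: nAa; rewrite -xa].
split; first by split; [exact: subS.1|move=> /esym].
move=> x y [Sx xa] [Sy ya]; split; first exact: subS.2.
move=> /esym e; case: (irr_a x y Sx Sy e) => z0; move: e; rewrite z0.
- by rewrite add0r => e; apply: ya.
- by rewrite addr0 => e; apply: xa.
Qed.

End Generation.

(** * Submonoids of $\mathbb{N}^p$, embedding dimension and monomial orders *)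

Section Vectors.
Variable p : nat.
Implicit Types (x y : 'N^p) (S : set 'N^p).

Lemma ffun_natD x y i : (x + y) i = (x i + y i)%N.
Proof. by rewrite ffunE. Qed.

Definition weight x : nat := \sum_i x i.

Lemma weightD x y : weight (x + y) = (weight x + weight y)%N.
Proof. by rewrite /weight -big_split /=; apply: eq_bigr => i _; rewrite ffunE. Qed.

Lemma weight_gt0 x : x <> 0 -> (0 < weight x)%N.
Proof.
rewrite lt0n => x0; apply/eqP => /eqP; rewrite sum_nat_eq0 => /forallP w0.
by apply: x0; apply/ffunP => i; rewrite ffunE; exact/eqP/w0.
Qed.

Lemma finite_box N : finite_set [set x : 'N^p | forall i, (x i < N)%N].
Proof.
case: N => [|N].
  case: p => [|k]; last first.
    by apply: sub_finite_set (finite_set0 _) => x /(_ ord0).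
  by apply: sub_finite_set (finite_set1 0) => x _; apply/ffunP; case.
pose h (u : {ffun 'I_p -> 'I_N.+1}) : 'N^p := [ffun i => val (u i)].
apply: sub_finite_set (finite_image h (@finite_finset _ setT)) => x xN.
exists [ffun i => inord (x i)] => //.
by apply/ffunP => i; rewrite !ffunE /= inordK.
Qed.

(** Strong induction on the weight: a nonzero non-atom splits into two nonzero elements of [S], both
    of smaller weight. *)
Lemma atoms_generate S : submonoid S -> generates (atoms S) S.
Proof.
move=> subS; apply/generatesP; split=> // [x []//|B subB atB x].
have [n] := ubnP (weight x); elim: n x => // n IHn x; rewrite ltnS => wx Sx.
have [->|/eqP x0] := eqVneq x 0; first exact: subB.1.
have [/atB//|nat_x] := pselect (atoms S x).
have [y [z [[Sy Sz e] y0 z0]]] :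
    exists y z, [/\ [/\ S y, S z & x = y + z], y <> 0 & z <> 0].
  apply: contrapT => nyz; apply: nat_x; split=> // y z Sy Sz e.
  apply: contrapT => /not_orP[y0 z0]; apply: nyz.
  by exists y, z.
have wy := weight_gt0 y0; have wz := weight_gt0 z0.
move: wx; rewrite e weightD => wx.
by apply: subB.2; apply: IHn => //; lia.
Qed.

Lemma minimal_generating_set_atoms S : submonoid S ->
  [set A | minimal_generating_set A S] = [set atoms S].
Proof.
move=> subS; apply/seteqP; split=> [A [genA minA]|_ ->].
  apply/esym/minA; first exact: atoms_sub_generating.
  exact: atoms_generate.
split=> [|B BA genB]; first exact: atoms_generate.
by apply/seteqP; split=> //; exact: atoms_sub_generating.
Qed.

Lemma embedding_dimensionE S : submonoid S ->
  embedding_dimension S = ncard (atoms S).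
Proof.
move=> subS; rewrite /embedding_dimension minimal_generating_set_atoms //.
by congr ncard; apply: (@getPex _ [set atoms S]); exists (atoms S).
Qed.

Lemma cofinite_bound S : finite_set (gaps S) ->
  exists2 N, (0 < N)%N & forall x i, (N <= x i)%N -> S x.
Proof.
move=> /(finite_set_bound weight)[N bN]; exists N.+1 => // x i Nx.
apply: contrapT => /bN; rewrite /weight (bigD1 i) //=; lia.
Qed.

Definition axis_vector (N : nat) (i : 'I_p) : 'N^p :=
  [ffun k => if k == i then N else 0%N].

(** Let [N] be such that one coordinate at least [N] forces membership in [S]. If $x_i \ge 2N$,
    splitting off $N e_i$ leaves two nonzero elements of [S], so atoms lie in the box of side
    $2N$. *)
Lemma finite_atoms S : finite_set (gaps S) -> finite_set (atoms S).
Proof.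
move=> /cofinite_bound[N N0 bN].
apply: sub_finite_set (finite_box (N + N)) => x [Sx x0 irr_x] i.
rewrite ltnNge; apply/negP => Nx.
pose y := axis_vector N i.
pose z : 'N^p := [ffun k => if k == i then (x i - N)%N else x k].
have yi : y i = N by rewrite ffunE eqxx.
have zi : z i = (x i - N)%N by rewrite ffunE eqxx.
have [|||/ffunP/(_ i)|/ffunP/(_ i)] := irr_x y z.
- by apply: (bN _ i); rewrite yi.
- by apply: (bN _ i); rewrite zi; lia.
- apply/ffunP => k; rewrite ffun_natD !ffunE.
  by case: eqP => [->|_]; rewrite ?subnKC // (leq_trans (leq_addr N N)).
- by rewrite yi ffunE => e; move: N0; rewrite e.
- by rewrite zi ffunE => /eqP; rewrite subn_eq0; lia.
Qed.

Lemma cofinite_Np_semigroup S :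
  submonoid S -> finite_set (gaps S) -> Np_semigroup S.
Proof.
move=> subS finS; split=> //; split=> //; exists (atoms S).
  exact: finite_atoms.
exact: atoms_generate.
Qed.

(** With at most one atom [a], all of [S] would consist of multiples of [a]; but [S] contains
    nonzero vectors on two different axes. *)
Lemma embedding_dimension_ge2 S : (2 <= p)%N ->
  submonoid S -> finite_set (gaps S) -> (2 <= embedding_dimension S)%N.
Proof.
move=> p2 subS finS; rewrite embedding_dimensionE // leqNgt; apply/negP => e1.
have [a at_a] : exists a, atoms S `<=` [set a].
  have finA := finite_atoms finS.
  have [->|/set0P[a Aa]] := eqVneq (atoms S) set0; first by exists 0.
  exists a => b Ab; apply: contrapT => /eqP ba.
  move: e1; rewrite ltnNge => /negP; apply.
  have <- : #|` [fset b; a]%fset| = 2%N by rewrite cardfs2 ba.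
  apply/fsubset_leq_card/fsubsetP => c; rewrite !inE in_fset_set //.
  by case/orP => /eqP->; exact: mem_set.
have /generatesP[_ _ minS] := atoms_generate subS.
have multS x : S x -> exists k, x = a *+ k.
  apply: (minS [set x | exists k, x = a *+ k]); last first.
    by move=> b /at_a ->; exists 1%N.
  split; first by exists 0%N.
  by move=> _ _ [k ->] [l ->]; exists (k + l)%N; rewrite mulrnDr.
have [N N0 bN] := cofinite_bound finS.
have muln_a k i : (a *+ k) i = (a i * k)%N.
  elim: k => [|k IHk]; first by rewrite mulr0n ffunE muln0.
  by rewrite mulrS ffun_natD IHk mulnS.
have axisS i : exists k, forall r, axis_vector N i r = (a r * k)%N.
  have [|k ->] := multS (axis_vector N i); last by exists k.
  by apply: (bN _ i); rewrite ffunE eqxx.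
pose i0 := Ordinal (ltnW p2); pose i1 := Ordinal p2.
have [[k ek] [l el]] := (axisS i0, axisS i1).
(* The first axis vector vanishes at [i1], so [a i1 = 0] or [k = 0]; either one makes [N] zero. *)
have := (ek i0, ek i1, el i1); rewrite !ffunE /= => -[[Nk /esym/eqP]].
rewrite muln_eq0 => /orP[/eqP-> Nl|/eqP k0].
  by move: N0; rewrite Nl.
by move: N0; rewrite Nk k0 muln0.
Qed.

(** Translate $0 \preceq y - x$ by $x$. This allows comparisons that hold for every monomial order
    at once. *)
Lemma monomial_order_leq (le : rel 'N^p) x y :
  monomial_order le -> (forall i, x i <= y i)%N -> le x y.
Proof.
move=> [_ leD le0] xy.
have -> : y = [ffun i => (y i - x i)%N] + x.
  by apply/ffunP => i; rewrite ffun_natD ffunE subnK.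
by rewrite -{1}[x]add0r; exact: leD.
Qed.

Lemma frobenius_elementE (le : rel 'N^p) S f :
  monomial_order le -> maximum le (gaps S) f ->
  frobenius_element le S = Some f.
Proof.
move=> [[_ asym _ _] _ _] fmax; rewrite /frobenius_element.
case: xgetP => [_ -> [g gmax <-]|/(_ (Some f))[]]; last by exists f.
congr Some; apply: asym.
by rewrite (gmax.2 f fmax.1) (fmax.2 g gmax.1).
Qed.

(** $n e \ge 2n \ge n + g$. *)
Lemma extended_wilf_genus (le : rel 'N^p) S :
  (2 <= embedding_dimension S)%N -> (genus S <= n_of le S)%N ->
  extended_wilf le S.
Proof. by rewrite /extended_wilf /frobenius_number; nia. Qed.

End Vectors.

(** * Symmetry of numerical semigroups with two generators *)

Section TwoGenerators.
Variables (T : set nat) (a b : nat).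
Hypothesis (T_cofinite : finite_set (~` T)).
Hypothesis (T_gen : generates [set a; b] T).

Lemma two_generatedP x : T x <-> exists u v, x = (u * a + v * b)%N.
Proof.
have /generatesP[[T0 TD] abT minT] := T_gen; split.
  apply: (minT [set x | exists u v, x = (u * a + v * b)%N]).
    split; first by exists 0%N, 0%N.
    move=> _ _ [u [v ->]] [u' [v' ->]]; exists (u + u')%N, (v + v')%N.
    by rewrite /GRing.add /=; lia.
  by move=> _ [->|->]; [exists 1%N, 0%N|exists 0%N, 1%N]; lia.
have mulT c n : T c -> T (n * c)%N.
  by move=> Tc; elim: n => [|n IHn] //; rewrite mulSn; exact: TD.
move=> [u [v ->]]; apply: TD; apply: mulT; apply: abT; first by left.
by right.
Qed.

(** The gcd divides every element of [T], and a cofinite [T] contains two consecutive integers. *)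
Lemma two_generated_coprime : coprime a b.
Proof.
have [N bN] := finite_set_bound id T_cofinite.
have T_ge x : (N <= x)%N -> T x.
  by move=> Nx; apply: contrapT => /bN; rewrite ltnNge Nx.
have dvT x : T x -> (gcdn a b %| x)%N.
  move=> /two_generatedP[u [v ->]].
  by rewrite dvdn_add // dvdn_mull // (dvdn_gcdl, dvdn_gcdr).
have := dvT _ (T_ge N.+1 (leqnSn N)).
by rewrite -addn1 dvdn_addr ?dvdn1 //; exact: dvT (T_ge N (leqnn N)).
Qed.

(** Here [f] is Sylvester's $ab - a - b$. A gap has the form $x = ua - (v+1)b$ with $u < b$, whence
    $f - x = (b-1-u)a + vb$. The gap [x0] rules out $T = \mathbb{N}$. *)
Lemma two_generated_symmetric x0 : ~ T x0 ->
  exists2 f, ~ T f & forall x, ~ T x -> (x <= f)%N /\ T (f - x)%N.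
Proof.
move=> Tx0; have co := two_generated_coprime.
have a0 : (0 < a)%N.
  rewrite lt0n; apply/eqP => az; move: co; rewrite az /coprime gcd0n => /eqP b1.
  by apply: Tx0; apply/two_generatedP; exists 0%N, x0; rewrite b1; lia.
have b0 : (0 < b)%N.
  rewrite lt0n; apply/eqP => bz; move: co; rewrite bz /coprime gcdn0 => /eqP a1.
  by apply: Tx0; apply/two_generatedP; exists x0, 0%N; rewrite a1; lia.
(* This is $f - x \in T$ in additive form, free of truncated subtraction. *)
have reflect x : ~ T x -> exists u v, (x + u * a + v * b + a + b = a * b)%N.
  move=> Tx.
  (* [u] is the residue of [x / a] modulo [b]. *)
  have [u ub ux] : exists2 u, (u < b)%N & (u * a = x %[mod b])%N.
    have [k l e _] := egcdnP b a0; exists ((k * x) %% b)%N.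
       by rewrite ltn_mod.
    rewrite modnMml mulnAC e (eqP co) mulnDl mul1n.
    by rewrite mulnAC modnMDl.
  have xu : (x < u * a)%N.
    rewrite ltnNge; apply/negP => ux_le; apply: Tx.
    move/esym/eqP: ux; rewrite eqn_mod_dvd // => /dvdnP[v e].
    by apply/two_generatedP; exists u, v; lia.
  move/eqP: ux; rewrite eqn_mod_dvd; last exact: ltnW.
  move=> /dvdnP[[|v] e]; first by lia.
  exists (b - u.+1)%N, v; have : (a * b = a * u.+1 + a * (b - u.+1))%N.
    by rewrite -mulnDr subnKC.
  by lia.
exists (a * b - a - b)%N => [/two_generatedP[u [v e]]|x Tx].
  (* Reflecting [x0] gives $a + b \le ab$, so the subtractions in [f] are not truncated. *)
  have [u0 [v0 e0]] := reflect _ Tx0.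
  have {}e : (a * b = u.+1 * a + v.+1 * b)%N by lia.
  (* By coprimality [b] then divides $u+1$, so $(u+1)a \ge ab$, leaving no room for $(v+1)b > 0$. *)
  have : (b %| u.+1 * a)%N.
    by rewrite -(dvdn_addl _ (dvdn_mull v.+1 (dvdnn b))) -e dvdn_mull.
  rewrite Gauss_dvdl; last by rewrite coprime_sym.
  by move=> /dvdn_leq-/(_ isT) bu; nia.
have [u [v e]] := reflect x Tx; split; first lia.
by apply/two_generatedP; exists u, v; lia.
Qed.

End TwoGenerators.

(** * Gaps and genus of the box semigroup *)

Section Box.
Variables (p : nat) (T : set nat) (j : 'I_p) (q : 'I_p -> nat).
Let S := box_semigroup T j q.

Lemma gaps_box (x : 'N^p) :
  gaps S x <-> ~ T (x j) /\ forall i, i != j -> (x i < q i)%N.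
Proof. by split=> [/contrapT|? []]. Qed.

(** If $x + y$ is a gap, both summands satisfy the bounds [q]; as [T] is closed under addition,
    $x_j$ or $y_j$ lies outside [T], making that summand a gap. *)
Lemma box_submonoid : submonoid T -> submonoid S.
Proof.
move=> [T0 TD]; split=> [[]|x y Sx Sy []]; first by rewrite ffunE.
rewrite ffunE => Txy xyq; apply: Txy; apply: TD; apply: contrapT => nT.
  by apply: Sx; split=> // i /xyq; rewrite ffun_natD; lia.
by apply: Sy; split=> // i /xyq; rewrite ffun_natD; lia.
Qed.

Lemma finite_gaps_box : finite_set (~` T) -> finite_set (gaps S).
Proof.
move=> /(finite_set_bound id)[N bN].
apply: sub_finite_set (finite_box p (N + \max_i q i)) => x.
move=> /gaps_box[/bN xj xq] i.
have [->|/xq xi] := eqVneq i j; first exact: ltn_addr.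
by apply: leq_trans xi _; rewrite (leq_trans (leq_bigmax i)) ?leq_addl.
Qed.

Lemma genus_box_le (le : rel 'N^p) :
  finite_set (~` T) ->
  (forall x0, ~ T x0 ->
    exists2 f, ~ T f & forall x, ~ T x -> (x <= f)%N /\ T (f - x)%N) ->
  monomial_order le -> finitely_preceded le ->
  (genus S <= n_of le S)%N.
Proof.
move=> T_cofinite T_sym mon fin.
have [G0|] := eqVneq (gaps S) set0; first by rewrite /genus G0 ncard_set0.
case/set0P => g /gaps_box[Tg gq]; have [f Tf symf] := T_sym _ Tg.
(* The gap [g] shows $q_i > 0$ for $i \ne j$, so the predecessor is a true $q_i - 1$. *)
pose F : 'N^p := [ffun i => if i == j then f else (q i).-1].
have Fj : F j = f by rewrite ffunE eqxx.
have GF : gaps S F.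
  apply/gaps_box; rewrite Fj; split=> // i ij; rewrite ffunE (negPf ij).
  by have := gq i ij; lia.
have Fmax : maximum le (gaps S) F.
  split=> // x /gaps_box[Tx xq]; apply: monomial_order_leq => // i.
  rewrite ffunE; case: eqVneq => [->|/xq]; last lia.
  by have [] := symf _ Tx.
rewrite /n_of /prec_frobenius (frobenius_elementE mon Fmax).
pose h (x : 'N^p) : 'N^p := [ffun i => if i == j then (f - x j)%N else x i].
have hj x : h x j = (f - x j)%N by rewrite ffunE eqxx.
apply: (leq_ncard (h := h)).
- exact: finite_gaps_box.
(* [ncard] is 0 on infinite sets, so the target must be finite; [finitely_preceded] ensures it. *)
- by apply: sub_finite_set (fin F) => x [].
- move=> x /gaps_box[Tx xq]; have [xf Tfx] := symf _ Tx.
  have Shx : S (h x) by case; rewrite hj.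
  (* [h x] is componentwise below [F], and differs from it because [F] is a gap. *)
  split=> //; rewrite /prec; apply/andP; split; last first.
    by apply/eqP => e; apply: GF; rewrite -e.
  apply: monomial_order_leq => // i; rewrite !ffunE.
  by case: eqVneq => [_|/xq]; lia.
- move=> x y /set_mem/gaps_box[Tx _] /set_mem/gaps_box[Ty _] e.
  have [[xf _] [yf _]] := (symf _ Tx, symf _ Ty).
  apply/ffunP => i; move/ffunP/(_ i): e; rewrite !ffunE.
  by case: eqVneq => [-> e|//]; rewrite -(subKn xf) e subKn.
Qed.

End Box.

Theorem lemma13 (p : nat) (p_ge2 : (2 <= p)%N)
    (T : set nat) (lambda1 lambda2 : nat)
    (T_numerical : numerical_semigroup T)
    (T_gen : minimal_generating_set [set lambda1; lambda2] T)
    (j : 'I_p) (q : 'I_p -> nat) :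
  Np_semigroup (box_semigroup T j q) /\
  forall le : rel 'N^p,
    monomial_order le -> finitely_preceded le ->
    extended_wilf le (box_semigroup T j q).
Proof.
have [T_sub T_cofinite] := T_numerical.
have subS := box_submonoid j q T_sub.
have finS := finite_gaps_box j q T_cofinite.
split=> [|le mon fin]; first exact: cofinite_Np_semigroup.
apply: extended_wilf_genus; first exact: embedding_dimension_ge2.
apply: genus_box_le => // x0.
exact: two_generated_symmetric T_cofinite T_gen.1 x0.
Qed.
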